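(* Let $x^{*}:m_{\mathbb{R}_{\mathcal F}}\to\mathbb{R}$ be a map. Then $x^{*}$ is a linear continuous functional (continuity with respect to the metric $\mu$) if and only if there exists a linear functional $L:M\overline{C}[0,1]\to\mathbb{R}$ such that $$x^{*}(x)=L(x_{-}+x_{+})\quad\text{for all } x=(x_n)_n\in m_{\mathbb{R}_{\mathcal F}},$$ and such that the restriction of $L$ to $MIC[0,1]$ is continuous with respect to the metric $$\Phi[(s_n)_n,(t_n)_n]=\sup\{\|s_n-t_n\|: n\in\mathbb{N}\},$$ where $\|\cdot\|$ is the uniform norm on $\overline{C}[0,1]$.
   Context: Fuzzy numbers: $\mathbb{R}_{\mathcal F}$ is the set of all functions $u:\mathbb{R}\to[0,1]$ such that (i) there is $x_u\in\mathbb{R}$ with $u(x_u)=1$; (ii) $u(tx+(1-t)y)\ge\min\{u(x),u(y)\}$ for all $t\in[0,1]$, $x,y\in\mathbb{R}$; (iii) $u$ is upper semicontinuous on $\mathbb{R}$; (iv) the closure of $\{x\in\mathbb{R}: u(x)>0\}$ is compact. Level sets: for $0<r\le 1$, $[u]^r=\{x\in\mathbb{R}:u(x)\ge r\}$, and $[u]^0=\overline{\{x\in\mathbb{R}:u(x)>0\}}$. Each $[u]^r$ is a compact interval, written $[u]^r=[u_-(r),u_+(r)]$; this defines functions $u_-,u_+:[0,1]\to\mathbb{R}$, which belong to the space $\overline{C}[0,1]$ below. Operations: $(u\oplus v)(x)=\sup_{y+z=x}\min\{u(y),v(z)\}$; for $\lambda\in\mathbb{R}$, $(\lambda\odot u)(x)=u(x/\lambda)$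 if $\lambda\ne0$, and $0\odot u=\widetilde 0:=\chi_{\{0\}}$. Equivalently, $[u\oplus v]^r=[u]^r+[v]^r$ and $[\lambda\odot u]^r=\lambda[u]^r$ for all $r\in[0,1]$. Metric: $D(u,v)=\sup_{r\in[0,1]}\max\{|u_-(r)-v_-(r)|,|u_+(r)-v_+(r)|\}$, and $\|u\|_{\mathcal F}=D(u,\widetilde 0)$. $m_{\mathbb{R}_{\mathcal F}}$ is the set of sequences $x=(x_n)_{n\in\mathbb{N}}$ in $\mathbb{R}_{\mathcal F}$ for which there is $M>0$ with $\|x_n\|_{\mathcal F}\le M$ for all $n\in\mathbb{N}$, with termwise operations $\oplus,\odot$ and the metric $\mu(x,y)=\sup\{D(x_n,y_n):n\in\mathbb{N}\}$. A functional $A:m_{\mathbb{R}_{\mathcal F}}\to\mathbb{R}$ is called linear if $A(x\oplus y)=A(x)+A(y)$ and $A(\lambda\odot x)=\lambda A(x)$ for all $x,y\in m_{\mathbb{R}_{\mathcal F}}$ and all $\lambda\in\mathbb{R}$. Continuous means continuous at every point. $\overline{C}[0,1]$ is the real Banach space of all bounded functions $f:[0,1]\to\mathbb{R}$ that are left continuous at each point of $(0,1]$, have a right limit at each point of $[0,1)$, and are right continuous at $0$, with the uniform norm $\|f\|=\sup\{|f(x)|:x\in[0,1]\}$. $IC[0,1]=\{f\in\overline{C}[0,1]: f\text{ is increasing on }[0,1]\}$, where increasing means nondecreasing. $M\overline{C}[0,1]=\{(s_n)_n: s_n\in\overline{C}[0,1]\ \forall n\in\mathbb{N},\ (s_n)_n\text{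 is uniformly bounded}\}$, a real vector space under termwise operations, and $MIC[0,1]=\{(s_n)_n: s_n\in IC[0,1]\ \forall n\in\mathbb{N},\ (s_n)_n\text{ is uniformly bounded}\}$ (uniformly bounded: $\sup_n\|s_n\|<+\infty$). $L$ is linear in the usual vector space sense. For $x=(x_n)_n\in m_{\mathbb{R}_{\mathcal F}}$, $x_-=((x_n)_-)_n$ and $x_+=((x_n)_+)_n$; these are uniformly bounded sequences, so they lie in $M\overline{C}[0,1]$. *)

(* Defs.v *)
From HB Require Import structures.
From mathcomp Require Import all_boot all_order all_algebra.
From mathcomp Require Import interval_inference boolp classical_sets functions.
From mathcomp Require Import reals topology normedtype numfun.
From mathcomp Require Import ring lra.

Set Implicit Arguments.
Unset Strict Implicit.
Unset Printing Implicit Defensive.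

Import Order.TTheory GRing.Theory Num.Theory.
Import numFieldTopology.Exports numFieldNormedType.Exports.

Local Open Scope classical_set_scope.
Local Open Scope ring_scope.

(* The unit interval as a type, with the subspace topology. *)
Definition I01 (R : realType) : Type := set_type `[0 : R, 1 : R]%classic.

HB.instance Definition _ (R : realType) :=
  PseudoMetric.copy (I01 R) (set_type `[0 : R, 1 : R]%classic).

Definition I01_val (R : realType) (r : I01 R) : R := \val r.

Definition left_of (R : realType) (r : I01 R) : set_system (I01 R) :=
  within [set q : I01 R | I01_val q < I01_val r] (nbhs r).

Definition right_of (R : realType) (r : I01 R) : set_system (I01 R) :=
  within [set q : I01 R | I01_val r < I01_val q] (nbhs r).

Section unit_interval.
Context {R : realType}.
Implicit Types (p q r : I01 R).

Lemma I01P r : 0 <= I01_val r <= 1.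
Proof. by case: r => x; rewrite /I01_val /= inE /= in_itv. Qed.

Lemma I01_ge0 r : 0 <= I01_val r. Proof. by case/andP: (I01P r). Qed.

Lemma I01_le1 r : I01_val r <= 1. Proof. by case/andP: (I01P r). Qed.

Lemma I01_proof (x : R) : 0 <= x <= 1 -> x \in `[0 : R, 1]%classic.
Proof. by move=> x01; rewrite inE /= in_itv. Qed.

Definition toI01 (x : R) (x01 : 0 <= x <= 1) : I01 R :=
  exist _ x (I01_proof x01).

Lemma near_I01 r (d : R) : 0 < d ->
  \forall q \near r, `|I01_val r - I01_val q| < d.
Proof. by move=> d0; apply/nbhs_ballP; exists d => // q. Qed.

Lemma left_of_cvg (f : I01 R -> R) r :
  (forall e, 0 < e -> exists2 d, 0 < d &
    forall q, I01_val r - d < I01_val q -> I01_val q < I01_val r -> `|f r - f q| <= e) ->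
  f q @[q --> left_of r] --> f r.
Proof.
move=> H; apply/cvgrPdist_le => e /H[d d0 Hd].
rewrite near_withinE; near=> q => qr; apply: Hd => //.
have : `|I01_val r - I01_val q| < d by near: q; exact: near_I01.
by move=> /(le_lt_trans (ler_norm _)); lra.
Unshelve. all: by end_near. Qed.

Lemma right_of_cvg (f : I01 R -> R) r (l : R) :
  (forall e, 0 < e -> exists2 d, 0 < d &
    forall q, I01_val r < I01_val q -> I01_val q < I01_val r + d -> `|l - f q| <= e) ->
  f q @[q --> right_of r] --> l.
Proof.
move=> H; apply/cvgrPdist_le => e /H[d d0 Hd].
rewrite near_withinE; near=> q => qr; apply: Hd => //.
have : `|I01_val r - I01_val q| < d by near: q; exact: near_I01.
by rewrite distrC => /(le_lt_trans (ler_norm _)); lra.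
Unshelve. all: by end_near. Qed.

Lemma bounded_funP (T : Type) (f : T -> R) :
  bounded_fun f <-> exists M, forall x, `|f x| <= M.
Proof.
split=> [[M [_ Mf]]|[M Mf]].
  by exists (M + 1) => x; apply: (Mf (M + 1)) => //; rewrite ltrDl.
exists M; split; first by rewrite num_real.
by move=> N MN x _ /=; exact: le_trans (ltW MN).
Qed.

End unit_interval.

Section sup_tools.
Context {R : realType} {T : Type}.
Implicit Types (f : T -> R).

Lemma sup_range_le f (M : R) (t0 : T) : (forall t, f t <= M) -> sup (range f) <= M.
Proof.
move=> fM; apply: ge_sup; first by exists (f t0), t0.
by move=> _ [t _ <-].
Qed.

Lemma le_sup_range f (M : R) t : (forall t, f t <= M) -> f t <= sup (range f).
Proof.
by move=> fM; apply: ub_le_sup; [exists M => _ [s _ <-] | exists t].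
Qed.

End sup_tools.

(* C-bar[0,1]: bounded, left continuous on (0,1], with right limits on [0,1),
   right continuous at 0. *)
Definition is_Cbar (R : realType) (f : I01 R -> R) : Prop :=
  [/\ bounded_fun f,
      forall r : I01 R, 0 < I01_val r -> f q @[q --> left_of r] --> f r,
      forall r : I01 R, I01_val r < 1 -> cvg (f q @[q --> right_of r]) &
      forall r : I01 R, I01_val r = 0 -> f q @[q --> right_of r] --> f r].

Definition Cbar_pred (R : realType) : {pred I01 R -> R} :=
  [pred f | `[< is_Cbar f >]].

Lemma Cbar_submod_closed (R : realType) : submod_closed (@Cbar_pred R).
Proof.
split.
  apply/asboolP; split.
  - by apply/bounded_funP; exists 0 => x; rewrite normr0.
  - by move=> r _; exact: cvg_cst.
  - by move=> r _; exact: is_cvg_cst.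
  - by move=> r _; exact: cvg_cst.
move=> a f g /asboolP[bf lf rf zf] /asboolP[bg lg rg zg]; apply/asboolP; split.
- have /bounded_funP[M Mf] := bf; have /bounded_funP[N Ng] := bg.
  apply/bounded_funP; exists (`|a| * M + N) => x.
  rewrite (le_trans (ler_normD _ _))// lerD//.
  by rewrite normrM ler_wpM2l.
- by move=> r r0; apply: cvgD; [apply: cvgZl_tmp; exact: lf | exact: lg].
- by move=> r r0; apply: is_cvgD; [apply: is_cvgZl_tmp; exact: rf | exact: rg].
- by move=> r r0; apply: cvgD; [apply: cvgZl_tmp; exact: zf | exact: zg].
Qed.

HB.instance Definition _ (R : realType) :=
  GRing.isSubmodClosed.Build R (I01 R -> R) (@Cbar_pred R)
    (@Cbar_submod_closed R).

Record Cbar (R : realType) := MkCbar {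
  Cbar_val :> I01 R -> R ;
  Cbar_valP : Cbar_val \in @Cbar_pred R }.

HB.instance Definition _ (R : realType) := [isSub for @Cbar_val R].
HB.instance Definition _ (R : realType) := [Choice of Cbar R by <:].
HB.instance Definition _ (R : realType) :=
  [SubChoice_isSubLmodule of Cbar R by <:].

Definition Cnorm (R : realType) (f : Cbar R) : R :=
  sup (range (fun r => `|f r|)).

Section Cnorm_theory.
Context {R : realType}.
Implicit Types (f g : Cbar R).

Lemma I01_0 : 0 <= (0 : R) <= 1. Proof. by rewrite lexx ler01. Qed.

Lemma Cnorm_le f (M : R) : (forall r, `|f r| <= M) -> Cnorm f <= M.
Proof. exact: sup_range_le (toI01 I01_0). Qed.

Lemma le_Cnorm f r : `|f r| <= Cnorm f.
Proof.
have /asboolP[/bounded_funP[M fM] _ _ _] := Cbar_valP f.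
exact: (@le_sup_range R _ (fun r => `|f r|) M).
Qed.

Lemma Cnorm_ge0 f : 0 <= Cnorm f.
Proof. exact: le_trans (le_Cnorm f (toI01 I01_0)). Qed.

Lemma Cnorm_eq0 f : Cnorm f = 0 -> f = 0.
Proof.
move=> f0; apply/val_inj/funext => r /=; apply/eqP; rewrite -normr_le0 -f0.
exact: le_Cnorm.
Qed.

Lemma CnormD f g : Cnorm (f + g) <= Cnorm f + Cnorm g.
Proof.
apply: Cnorm_le => r; rewrite (le_trans (ler_normD _ _))//.
by apply: lerD; exact: le_Cnorm.
Qed.

Lemma CnormZ a f : Cnorm (a *: f) <= `|a| * Cnorm f.
Proof. by apply: Cnorm_le => r; rewrite normrM ler_wpM2l// le_Cnorm. Qed.

Lemma Cnorm0 : Cnorm (0 : Cbar R) = 0.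
Proof.
by apply/le_anti; rewrite Cnorm_ge0 andbT; apply: Cnorm_le => r; rewrite normr0.
Qed.

Lemma CnormN f : Cnorm (- f) = Cnorm f.
Proof.
suff H g : Cnorm (- g) <= Cnorm g.
  by apply/le_anti; rewrite H -{1}(opprK f) H.
by rewrite -scaleN1r (le_trans (CnormZ _ _))// normrN1 mul1r.
Qed.

End Cnorm_theory.

(* MC-bar[0,1]: the uniformly bounded sequences in C-bar[0,1]. *)
Definition MCbar_pred (R : realType) : {pred nat -> Cbar R} :=
  [pred s | `[< exists M, forall n, Cnorm (s n) <= M >]].

Lemma MCbar_submod_closed (R : realType) : submod_closed (@MCbar_pred R).
Proof.
split; first by apply/asboolP; exists 0 => n; rewrite Cnorm0.
move=> a s t /asboolP[M sM] /asboolP[N tN]; apply/asboolP.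
exists (`|a| * M + N) => n; rewrite (le_trans (CnormD _ _))// lerD//.
by rewrite (le_trans (CnormZ _ _))// ler_wpM2l.
Qed.

HB.instance Definition _ (R : realType) :=
  GRing.isSubmodClosed.Build R (nat -> Cbar R) (@MCbar_pred R)
    (@MCbar_submod_closed R).

Record MCbar (R : realType) := MkMCbar {
  MCbar_val :> nat -> Cbar R ;
  MCbar_valP : MCbar_val \in @MCbar_pred R }.

HB.instance Definition _ (R : realType) := [isSub for @MCbar_val R].
HB.instance Definition _ (R : realType) := [Choice of MCbar R by <:].
HB.instance Definition _ (R : realType) :=
  [SubChoice_isSubLmodule of MCbar R by <:].

Definition Phi (R : realType) (s t : MCbar R) : R :=
  sup (range (fun n => Cnorm (s n - t n))).

Section Phi_theory.
Context {R : realType}.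
Implicit Types (s t u : MCbar R).

Lemma Phi_le s t (M : R) : (forall n, Cnorm (s n - t n) <= M) -> Phi s t <= M.
Proof. exact: sup_range_le 0%N. Qed.

Lemma le_Phi s t n : Cnorm (s n - t n) <= Phi s t.
Proof.
have /asboolP[M sM] := MCbar_valP s; have /asboolP[N tN] := MCbar_valP t.
apply: (@le_sup_range R nat (fun n => Cnorm (s n - t n)) (M + N)) => {}n.
by rewrite (le_trans (CnormD _ _))// CnormN lerD.
Qed.

Lemma Phixx s : Phi s s = 0.
Proof.
apply/le_anti/andP; split; last exact: le_trans (Cnorm_ge0 _) (le_Phi s s 0).
by apply: Phi_le => n; rewrite subrr Cnorm0.
Qed.

Lemma Phi_eq0 s t : Phi s t = 0 -> s = t.
Proof.
move=> st; apply/val_inj/funext => n; apply/eqP; rewrite -subr_eq0; apply/eqP.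
apply: Cnorm_eq0; apply/le_anti; rewrite Cnorm_ge0 andbT.
by rewrite (le_trans (le_Phi s t n))// st.
Qed.

Lemma Phi_sym s t : Phi s t = Phi t s.
Proof.
have H u v : Phi u v <= Phi v u.
  by apply: Phi_le => n; rewrite -CnormN opprB le_Phi.
by apply/le_anti; rewrite !H.
Qed.

Lemma Phi_triangle t s u : Phi s u <= Phi s t + Phi t u.
Proof.
apply: Phi_le => n; rewrite -(subrKA (t n)).
by rewrite (le_trans (CnormD _ _))// lerD// le_Phi.
Qed.

End Phi_theory.

HB.instance Definition _ (R : realType) :=
  @isMetric.Build R (MCbar R) (@Phi R) (@Phixx R) (@Phi_eq0 R) (@Phi_sym R)
    (@Phi_triangle R).

Definition IC (R : realType) : set (Cbar R) :=
  [set f | forall p q : I01 R, I01_val p <= I01_val q -> f p <= f q].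

(* Uniform boundedness is already part of MCbar. *)
Definition MIC (R : realType) : set (MCbar R) := [set s | forall n, IC (s n)].

Definition upper_semicontinuous (R : realType) (u : R -> R) : Prop :=
  forall x a : R, u x < a -> \forall y \near x, u y < a.

Definition is_fuzzy (R : realType) (u : R -> R) : Prop :=
  [/\ forall x, 0 <= u x <= 1,
      exists x, u x = 1,
      forall t x y : R, 0 <= t <= 1 ->
        Num.min (u x) (u y) <= u (t * x + (1 - t) * y),
      upper_semicontinuous u &
      compact (closure [set x | 0 < u x])].

Record fuzzy (R : realType) := MkFuzzy {
  fuzzy_val :> R -> R ;
  fuzzy_valP : is_fuzzy fuzzy_val }.

Lemma fuzzyP (R : realType) (u v : fuzzy R) : (forall x, u x = v x) -> u = v.
Proof.
case: u v => u up [v vp] /= /funext uv; rewrite {}uv in up *.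
by rewrite (Prop_irrelevance up vp).
Qed.

Definition level (R : realType) (u : R -> R) (r : R) : set R :=
  if r == 0 then closure [set x | 0 < u x] else [set x | r <= u x].

Definition lower (R : realType) (u : R -> R) (r : I01 R) : R :=
  inf (level u (I01_val r)).

Definition upper (R : realType) (u : R -> R) (r : I01 R) : R :=
  sup (level u (I01_val r)).

Section fuzzy_theory.
Context {R : realType}.
Implicit Types (u v w : fuzzy R) (r : I01 R) (x y z a M : R).

Lemma fuzzy_ge0 u x : 0 <= u x.
Proof. by have [/(_ x)/andP[]] := fuzzy_valP u. Qed.

Lemma fuzzy_le1 u x : u x <= 1.
Proof. by have [/(_ x)/andP[]] := fuzzy_valP u. Qed.

Lemma fuzzy_between u x y z : x <= y <= z -> Num.min (u x) (u z) <= u y.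
Proof.
have [_ _ cu _ _] := fuzzy_valP u => /andP[xy yz].
have [xz|zx] := ltP x z; last first.
  have -> : y = x by lra.
  by rewrite ge_min lexx.
have -> : y = (z - y) / (z - x) * x + (1 - (z - y) / (z - x)) * z.
  by field; rewrite subr_eq0 gt_eqF.
by apply: cu; rewrite divr_ge0 ?ler_pdivrMr; lra.
Qed.

Definition supported_in (M : R) (u : R -> R) := forall x : R, 0 < u x -> `|x| <= M.

Lemma closure_supported (M : R) (u : R -> R) : supported_in M u ->
  closure [set x | 0 < u x] `<=` `[- M, M]%classic.
Proof.
move=> uM; have cI : closed `[- M, M]%classic by exact: itv_closed.
move=> x /(closure_subset _) h; apply: cI; apply: h => y /= y0.
by rewrite in_itv /= -ler_norml uM.
Qed.

Lemma compact_supported (M : R) (u : R -> R) : supported_in M u ->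
  compact (closure [set x | 0 < u x]).
Proof.
move=> /closure_supported; apply: subclosed_compact; first exact: closed_closure.
exact: segment_compact.
Qed.

Lemma fuzzy_supported u : exists2 M, 0 < M & supported_in M u.
Proof.
have [_ _ _ _ /compact_bounded[M [_ Mu]]] := fuzzy_valP u.
exists (`|M| + 1) => [|x ux]; first by rewrite ltr_wpDl.
apply: (Mu (`|M| + 1)); last exact: subset_closure.
by rewrite (le_lt_trans (ler_norm _))// ltrDl.
Qed.

Lemma level_supported M u r x : supported_in M u ->
  level u (I01_val r) x -> `|x| <= M.
Proof.
rewrite /level; case: eqVneq => [_|r0] uM.
  by move=> /(closure_supported uM) /=; rewrite in_itv /= ler_norml.
move=> /= rx; apply: uM; apply: lt_le_trans rx.
by rewrite lt_neqAle eq_sym r0 I01_ge0.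
Qed.

Lemma core_level u r x : u x = 1 -> level u (I01_val r) x.
Proof.
rewrite /level => ux; case: eqVneq => _ /=; last by rewrite ux I01_le1.
by apply: subset_closure; rewrite /= ux.
Qed.

Lemma level_neq0 u r : level u (I01_val r) !=set0.
Proof.
by have [_ [x ux] _ _ _] := fuzzy_valP u; exists x; exact: core_level.
Qed.

Lemma level_lb u r : has_lbound (level u (I01_val r)).
Proof.
have [M _ uM] := fuzzy_supported u; exists (- M) => x /(level_supported uM).
by rewrite ler_norml => /andP[].
Qed.

Lemma level_ub u r : has_ubound (level u (I01_val r)).
Proof.
have [M _ uM] := fuzzy_supported u; exists M => x /(level_supported uM).
by rewrite ler_norml => /andP[].
Qed.

Lemma lower_le u r x : level u (I01_val r) x -> lower u r <= x.
Proof. by apply: ge_inf; exact: level_lb. Qed.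

Lemma le_upper u r x : level u (I01_val r) x -> x <= upper u r.
Proof. by apply: ub_le_sup; exact: level_ub. Qed.

Lemma lower_supported M u r : supported_in M u -> `|lower u r| <= M.
Proof.
move=> uM; rewrite ler_norml; apply/andP; split.
  apply: lb_le_inf; first exact: level_neq0.
  by move=> x /(level_supported uM); rewrite ler_norml => /andP[].
have [x ux] := level_neq0 u r; rewrite (le_trans (lower_le ux))//.
by move: ux => /(level_supported uM); rewrite ler_norml => /andP[].
Qed.

Lemma upper_supported M u r : supported_in M u -> `|upper u r| <= M.
Proof.
move=> uM; rewrite ler_norml; apply/andP; split; last first.
  apply: ge_sup; first exact: level_neq0.
  by move=> x /(level_supported uM); rewrite ler_norml => /andP[].
have [x ux] := level_neq0 u r; rewrite (le_trans _ (le_upper ux))//.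
by move: ux => /(level_supported uM); rewrite ler_norml => /andP[].
Qed.

Lemma level_closed u r : closed (level u (I01_val r)).
Proof.
rewrite /level; case: eqVneq => _; first exact: closed_closure.
have [_ _ _ usc _] := fuzzy_valP u.
rewrite -[X in closed X]setCK; apply: open_closedC; rewrite openE => x /= xr.
have {}xr : u x < I01_val r by rewrite ltNge; apply/negP.
by apply: filterS (usc _ _ xr) => y; rewrite ltNge => /negP.
Qed.

Lemma lower_level u r : level u (I01_val r) (lower u r).
Proof.
have /closure_id -> := @level_closed u r.
move=> B /nbhs_ballP[e /= e0 eB].
have ni : has_inf (level u (I01_val r)).
  by split; [exact: level_neq0|exact: level_lb].
have [y uy ye] := inf_adherent e0 ni; exists y; split => //; apply: eB.
by rewrite /ball /= ler0_norm ?opprB ?ltrBlDl// subr_le0 lower_le.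
Qed.

Lemma upper_level u r : level u (I01_val r) (upper u r).
Proof.
have /closure_id -> := @level_closed u r.
move=> B /nbhs_ballP[e /= e0 eB].
have ni : has_sup (level u (I01_val r)).
  by split; [exact: level_neq0|exact: level_ub].
have [y uy ye] := sup_adherent e0 ni; exists y; split => //; apply: eB.
by rewrite /ball /= ger0_norm ?subr_ge0 ?le_upper// ltrBlDl -ltrBlDr.
Qed.

Lemma closure_lt (S : set R) a x : closure S a -> a < x ->
  exists2 y, S y & y < x.
Proof.
move=> /(_ [set y | y < x]) h ax.
by have [|y [Sy yx]] := h; [exact: lt_nbhsl | exists y].
Qed.

Lemma closure_gt (S : set R) a x : closure S a -> x < a ->
  exists2 y, S y & x < y.
Proof.
move=> /(_ [set y | x < y]) h xa.
by have [|y [Sy yx]] := h; [exact: lt_nbhsr | exists y].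
Qed.

Lemma level_itvP u r x :
  level u (I01_val r) x <-> lower u r <= x <= upper u r.
Proof.
split=> [ux|/andP[]]; first by rewrite lower_le// le_upper.
rewrite le_eqVlt => /predU1P[<- _|lx]; first exact: lower_level.
rewrite le_eqVlt => /predU1P[->|xu]; first exact: upper_level.
have := lower_level u r; have := upper_level u r.
rewrite /level; case: eqVneq => [_ cu cl|_ /= ru rl]; last first.
  apply: le_trans (@fuzzy_between u (lower u r) x (upper u r) _).
    by rewrite le_min rl.
  by rewrite !ltW.
have [y /= uy xy] := closure_gt cu xu; have [z /= uz zx] := closure_lt cl lx.
apply: subset_closure => /=.
apply: lt_le_trans (@fuzzy_between u z x y _); first by rewrite lt_min uz.
by rewrite !ltW.
Qed.

Lemma level_itv u r :
  level u (I01_val r) = `[lower u r, upper u r]%classic.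
Proof.
by apply/seteqP; split => x /=; rewrite in_itv /= => /level_itvP.
Qed.

Lemma level_le u (r s : I01 R) : I01_val r <= I01_val s ->
  level u (I01_val s) `<=` level u (I01_val r).
Proof.
move=> rs x; have [rs'|rs'] := eqVneq (I01_val r) (I01_val s); first by rewrite rs'.
have s0 : 0 < I01_val s.
  by apply: le_lt_trans (I01_ge0 r) _; rewrite lt_neqAle rs'.
rewrite /level (gt_eqF s0); case: eqVneq => _ /= sx.
  by apply: subset_closure; exact: lt_le_trans sx.
exact: le_trans rs sx.
Qed.

Lemma lower_nd u (r s : I01 R) : I01_val r <= I01_val s -> lower u r <= lower u s.
Proof. by move=> /level_le rs; apply/lower_le/rs/lower_level. Qed.

Lemma upper_ni u (r s : I01 R) : I01_val r <= I01_val s -> upper u s <= upper u r.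
Proof. by move=> /level_le rs; apply/le_upper/rs/upper_level. Qed.

Lemma fuzzy_ext u v : lower u = lower v -> upper u = upper v -> u = v.
Proof.
move=> lE uE; apply: fuzzyP => x; apply/le_anti.
suff H (w w' : fuzzy R) : lower w = lower w' -> upper w = upper w' -> w x <= w' x.
  by rewrite !H.
move=> {}lE {}uE; have [wx|wx] := leP (w x) 0.
  exact: le_trans wx (fuzzy_ge0 _ _).
have x01 : 0 <= w x <= 1 by rewrite fuzzy_ge0 fuzzy_le1.
have : level w (I01_val (toI01 x01)) x by rewrite /level /= gt_eqF /=.
by rewrite level_itv lE uE -level_itv /level /= gt_eqF.
Qed.

Lemma closureN (u : R -> R) (x : R) :
  closure [set x | 0 < u x] x -> closure [set x | 0 < u (- x)] (- x).
Proof.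
move=> cx B Bx; have [|y [/= uy By]] := cx (-%R @^-1` B).
  exact: (@opp_continuous R x _ Bx).
by exists (- y); rewrite /= opprK.
Qed.

Lemma levelN (u : R -> R) (r x : R) : level (fun x => u (- x)) r x <-> level u r (- x).
Proof.
rewrite /level; case: eqVneq => _ /=; last by [].
split=> [/closureN|]; last by move=> /closureN; rewrite opprK.
by under eq_set do rewrite opprK.
Qed.

Lemma upperE (u : R -> R) r : upper u r = - lower (fun x => u (- x)) r.
Proof.
rewrite /upper /lower /inf opprK; congr (sup _); apply/seteqP; split => x /=.
  by move=> ux; exists (- x); rewrite ?opprK//; apply/levelN; rewrite opprK.
by move=> [y /levelN uy <-].
Qed.

Lemma is_fuzzyN u : is_fuzzy (fun x => u (- x)).
Proof.
have [u01 [x0 ux0] cu usc _] := fuzzy_valP u; split.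
- by move=> x.
- by exists (- x0); rewrite opprK.
- by move=> t x y t01; rewrite opprD -!mulrN; exact: cu.
- by move=> x a /usc h; exact: (@opp_continuous R x _ h).
- have [M _ uM] := fuzzy_supported u; apply: (@compact_supported M) => x /uM.
  by rewrite normrN.
Qed.

Lemma lower_Cbar u : lower u \in @Cbar_pred R.
Proof.
have [M _ uM] := fuzzy_supported u.
apply/asboolP; split.
- by apply/bounded_funP; exists M => r; exact: lower_supported.
- move=> r r0; apply: left_of_cvg => e e0.
  have uae : u (lower u r - e) < I01_val r.
    rewrite ltNge; apply/negP => h.
    have : level u (I01_val r) (lower u r - e) by rewrite /level gt_eqF.
    by move=> /lower_le; lra.
  exists (I01_val r - u (lower u r - e)); first by rewrite subr_gt0.
  move=> q; rewrite subKr => qu qr.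
  have q0 : 0 < I01_val q by exact: le_lt_trans (fuzzy_ge0 _ _) qu.
  have lq : lower u r - e <= lower u q.
    rewrite leNgt; apply/negP => h.
    have := lower_level u q; have := lower_level u r.
    rewrite /level !gt_eqF//= => ur uq.
    have := @fuzzy_between u (lower u q) (lower u r - e) (lower u r).
    rewrite ltW//= => /(_ _) h'.
    have := le_lt_trans (h' _) qu; rewrite gt_min lerBlDl lerDr ltW// => /(_ isT).
    by rewrite !ltNge uq (le_trans _ ur)// ltW.
  by rewrite ger0_norm ?subr_ge0 ?(lower_nd _ (ltW qr))//; lra.
- move=> r r1; apply/cvg_ex => /=.
  pose S := [set lower u q | q in [set q : I01 R | I01_val r < I01_val q]].
  have S0 : has_inf S.
    split; last by exists (lower u r) => _ [q /= rq <-]; exact/lower_nd/ltW.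
    have x01 : 0 <= (1 : R) <= 1 by rewrite ler01 lexx.
    by exists (lower u (toI01 x01)), (toI01 x01).
  exists (inf S); apply: right_of_cvg => e e0.
  have [_ [s /= rs <-] se] := inf_adherent e0 S0.
  exists (I01_val s - I01_val r); first by rewrite subr_gt0.
  move=> q rq; rewrite subrKC => qs.
  have h1 : lower u q <= lower u s by exact/lower_nd/ltW.
  have h2 : inf S <= lower u q by apply: ge_inf; [exact: S0.2 | exists q].
  by rewrite ler0_norm ?subr_le0//; lra.
- move=> r r0; apply: right_of_cvg => e e0.
  have := lower_level u r; rewrite /level r0 eqxx => /closure_lt.
  move=> /(_ (lower u r + e))[|x /= ux xe]; first by rewrite ltrDl.
  exists (u x) => // q; rewrite add0r => q0 qx.
  have h1 : lower u q <= x.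
    by apply: lower_le; rewrite /level gt_eqF//=; exact: ltW.
  have h2 : lower u r <= lower u q by apply: lower_nd; rewrite r0 ltW.
  by rewrite ler0_norm ?subr_le0//; lra.
Qed.

Lemma upper_Cbar u : upper u \in @Cbar_pred R.
Proof.
have -> : upper u = - lower (MkFuzzy (is_fuzzyN u)).
  by apply/funext => r; exact: upperE.
by rewrite rpredN; exact: lower_Cbar.
Qed.

End fuzzy_theory.

Definition lowerC (R : realType) (u : fuzzy R) : Cbar R :=
  MkCbar (lower_Cbar u).

Definition upperC (R : realType) (u : fuzzy R) : Cbar R :=
  MkCbar (upper_Cbar u).

Section fuzzy_operations.
Context {R : realType}.
Implicit Types (u v w : fuzzy R) (r : I01 R) (x y z l a M N : R).

Definition fzero_fun : R -> R := \1_[set 0].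

(* sup_(y + z = x) min (u y, v z); on fuzzy numbers the set is nonempty and
   bounded (fadd_neq0, fadd_le1), so the real-valued sup is the supremum. *)
Definition fadd_fun (u v : R -> R) (x : R) : R :=
  sup [set Num.min (u yz.1) (v yz.2) | yz in [set yz : R * R | yz.1 + yz.2 = x]].

Definition fscale_fun (l : R) (u : R -> R) : R -> R :=
  if l == 0 then fzero_fun else fun x => u (x / l).

Lemma fzero_funE x : fzero_fun x = (x == 0)%:R.
Proof.
rewrite /fzero_fun indicE; congr (nat_of_bool _)%:R.
by apply/idP/eqP; rewrite inE.
Qed.

Lemma fzero_supported : supported_in 0 fzero_fun.
Proof.
move=> x; rewrite fzero_funE; case: eqVneq => [->|_].
  by rewrite normr0.
by rewrite ltxx.
Qed.

Lemma is_fuzzy_fzero : is_fuzzy fzero_fun.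
Proof.
have zE := fzero_funE.
split.
- by move=> x; rewrite zE; case: eqP => _; rewrite ?lexx ?ler01.
- by exists 0; rewrite zE eqxx.
- move=> t x y t01; rewrite !zE; case: eqVneq => [->|x0].
    case: (eqVneq y 0) => [->|y0]; first by rewrite !mulr0 addr0 eqxx minxx.
    by rewrite ge_min orbC ler0n.
  by rewrite ge_min ler0n.
- move=> x a; rewrite zE; case: eqVneq => [_ a1|x0 a0].
    near=> y; rewrite zE; apply: le_lt_trans a1.
    by case: eqP => _; rewrite ?ler01.
  have : \forall y \near x, y != 0.
    by apply: open_nbhs_nbhs; split => //; exact: open_neq.
  by apply: filterS => y y0; rewrite zE (negPf y0).
- exact: compact_supported fzero_supported.
Unshelve. all: by end_near. Qed.

Definition fzero : fuzzy R := MkFuzzy is_fuzzy_fzero.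

Lemma fadd_le1 u v x yz :
  [set Num.min (u yz.1) (v yz.2) | yz in [set yz : R * R | yz.1 + yz.2 = x]] yz ->
  yz <= 1.
Proof. by move=> [[y z] /= _ <-]; rewrite ge_min fuzzy_le1. Qed.

Lemma le_fadd u v y z : Num.min (u y) (v z) <= fadd_fun u v (y + z).
Proof.
apply: ub_le_sup; first by exists 1 => x; exact: fadd_le1.
by exists (y, z).
Qed.

Lemma fadd_neq0 u v x :
  [set Num.min (u yz.1) (v yz.2) | yz in [set yz : R * R | yz.1 + yz.2 = x]]
  !=set0.
Proof. by exists (Num.min (u 0) (v x)), (0, x) => //=; rewrite add0r. Qed.

Lemma fadd_gt u v x a : a < fadd_fun u v x ->
  exists y z, [/\ y + z = x, a < u y & a < v z].
Proof.
move/(sup_gt (@fadd_neq0 u v x)) => [_ [[y z] /= yzx <-]].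
by rewrite lt_min => /andP[ay az]; exists y, z.
Qed.

Lemma fadd_supported M N u v : supported_in M u -> supported_in N v ->
  supported_in (M + N) (fadd_fun u v).
Proof.
move=> uM vN x /fadd_gt[y [z [<- uy vz]]].
by rewrite (le_trans (ler_normD _ _))// lerD// ?uM ?vN.
Qed.

Lemma is_fuzzy_fadd u v : is_fuzzy (fadd_fun u v).
Proof.
have w1 x : fadd_fun u v x <= 1.
  by apply: ge_sup => [|y]; [exact: fadd_neq0 | exact: fadd_le1].
have w0 x : 0 <= fadd_fun u v x.
  have := le_fadd u v 0 x; rewrite add0r; apply: le_trans.
  by rewrite le_min !fuzzy_ge0.
split.
- by move=> x; rewrite w0 w1.
- have [_ [x ux] _ _ _] := fuzzy_valP u; have [_ [y vy] _ _ _] := fuzzy_valP v.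
  exists (x + y); apply/le_anti; rewrite w1 /= (le_trans _ (le_fadd _ _ _ _))//.
  by rewrite ux vy minxx.
- move=> t x y t01; rewrite leNgt; apply/negP; rewrite lt_min => /andP[].
  move=> /fadd_gt[x1 [x2 [xE ux1 vx2]]] /fadd_gt[y1 [y2 [yE uy1 vy2]]].
  subst x y.
  have [_ _ cu _ _] := fuzzy_valP u; have [_ _ cv _ _] := fuzzy_valP v.
  have := le_fadd u v (t * x1 + (1 - t) * y1) (t * x2 + (1 - t) * y2).
  have -> : t * x1 + (1 - t) * y1 + (t * x2 + (1 - t) * y2) =
            t * (x1 + x2) + (1 - t) * (y1 + y2) by ring.
  rewrite leNgt => /negP; apply; rewrite lt_min.
  apply/andP; split.
    by apply: lt_le_trans (cu _ _ _ t01); rewrite lt_min ux1.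
  by apply: lt_le_trans (cv _ _ _ t01); rewrite lt_min vx2.
- move=> x a wxa.
  have [a1|a1] := ltP 1 a; first by near=> y; exact: le_lt_trans a1.
  have [b [wb ba]] : exists b, fadd_fun u v x < b /\ b < a.
    by exists ((fadd_fun u v x + a) / 2); rewrite !midf_lt.
  have b0 : 0 < b by exact: le_lt_trans (w0 x) wb.
  have b01 : 0 <= b <= 1 by rewrite ltW//= ltW// (lt_le_trans ba).
  pose r := toI01 b01; pose p := lower u r; pose q := upper u r.
  pose p' := lower v r; pose q' := upper v r.
  have lv (w : fuzzy R) z : level w (I01_val r) z <-> b <= w z.
    by rewrite /level /= gt_eqF.
  have out : x < p + p' \/ q + q' < x.
    have [?|h1] := ltP x (p + p'); first by left.
    have [?|h2] := ltP (q + q') x; first by right.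
    exfalso.
    have pq : p <= q by apply: lower_le; exact: upper_level.
    have pq' : p' <= q' by apply: lower_le; exact: upper_level.
    have uy : b <= u (Num.max p (x - q')).
      apply/lv/level_itvP; rewrite -/p -/q le_max lexx ge_max pq /=.
      by rewrite lerBlDr.
    have vz : b <= v (x - Num.max p (x - q')).
      apply/lv/level_itvP; rewrite -/p' -/q'.
      have [h|h] := leP p (x - q').
        by rewrite subKr pq' lexx.
      by rewrite lerBrDr addrC h1 /= ltW//; move: h; lra.
    have := le_fadd u v (Num.max p (x - q')) (x - Num.max p (x - q')).
    by rewrite subrKC leNgt (lt_le_trans wb)// le_min uy.
  have step y : a <= fadd_fun u v y -> p + p' <= y <= q + q'.
    move=> /(lt_le_trans ba)/fadd_gt[y1 [y2 [<- /ltW/lv uy1 /ltW/lv vy2]]].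
    by rewrite !lerD ?lower_le ?le_upper.
  case: out => out.
    have : \forall y \near x, y < p + p' by exact: lt_nbhsl.
    apply: filterS => y yp; rewrite ltNge; apply/negP => /step.
    by rewrite leNgt yp.
  have : \forall y \near x, q + q' < y by exact: lt_nbhsr.
  apply: filterS => y yp; rewrite ltNge; apply/negP => /step.
  by rewrite [_ <= q + q']leNgt yp andbF.
- have [M _ uM] := fuzzy_supported u; have [N _ vN] := fuzzy_supported v.
  exact: compact_supported (fadd_supported uM vN).
Unshelve. all: by end_near. Qed.

Definition fadd u v : fuzzy R := MkFuzzy (is_fuzzy_fadd u v).

Lemma fscale_supported l M u : supported_in M u ->
  supported_in (`|l| * M) (fscale_fun l u).
Proof.
rewrite /fscale_fun; case: eqVneq => [-> _|l0 uM x /uM].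
  by rewrite normr0 mul0r; exact: fzero_supported.
by rewrite normrM normfV mulrC ler_pdivrMl// normr_gt0.
Qed.

Lemma is_fuzzy_fscale l u : is_fuzzy (fscale_fun l u).
Proof.
have [M _ uM] := fuzzy_supported u.
have := compact_supported (@fscale_supported l M u uM).
rewrite /fscale_fun; case: eqVneq => [_ _|l0 cs]; first exact: is_fuzzy_fzero.
have [u01 [x0 ux0] cu usc _] := fuzzy_valP u; split => //.
- by exists (x0 * l); rewrite mulfK.
- by move=> t x y t01; rewrite mulrDl -!mulrA; exact: cu.
- by move=> x a /usc h; exact: (@mulrr_continuous R l^-1 x _ h).
Qed.

Definition fscale l u : fuzzy R := MkFuzzy (is_fuzzy_fscale l u).

Definition Dist u v : R :=
  sup (range (fun r =>
    Num.max `|lower u r - lower v r| `|upper u r - upper v r|)).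

Definition Fnorm u : R := Dist u fzero.

Lemma Dist_le u v M :
  (forall r, `|lower u r - lower v r| <= M) ->
  (forall r, `|upper u r - upper v r| <= M) -> Dist u v <= M.
Proof.
move=> lM uM; apply: sup_range_le (toI01 I01_0) _ => r.
by rewrite ge_max lM uM.
Qed.

Lemma Dist_ub u v : exists M, forall r,
  Num.max `|lower u r - lower v r| `|upper u r - upper v r| <= M.
Proof.
have [M _ uM] := fuzzy_supported u; have [N _ vN] := fuzzy_supported v.
exists (M + N) => r; rewrite ge_max !(le_trans (ler_normB _ _))// lerD//;
  by [exact: lower_supported|exact: upper_supported].
Qed.

Lemma lower_Dist u v r : `|lower u r - lower v r| <= Dist u v.
Proof.
have [M HM] := Dist_ub u v; have := le_sup_range r HM.
by apply: le_trans; rewrite le_max lexx.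
Qed.

Lemma upper_Dist u v r : `|upper u r - upper v r| <= Dist u v.
Proof.
have [M HM] := Dist_ub u v; have := le_sup_range r HM.
by apply: le_trans; rewrite le_max lexx orbT.
Qed.

Lemma Dist_ge0 u v : 0 <= Dist u v.
Proof. exact: le_trans (lower_Dist u v (toI01 I01_0)). Qed.

Lemma Distxx u : Dist u u = 0.
Proof.
apply/le_anti; rewrite Dist_ge0 andbT.
by apply: Dist_le => r; rewrite subrr normr0.
Qed.

Lemma Dist_eq0 u v : Dist u v = 0 -> u = v.
Proof.
move=> uv0; apply: fuzzy_ext; apply/funext => r; apply/eqP;
  rewrite -subr_eq0 -normr_le0 -uv0; by [exact: lower_Dist|exact: upper_Dist].
Qed.

Lemma Dist_sym u v : Dist u v = Dist v u.
Proof.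
have H w w' : Dist w w' <= Dist w' w.
  by apply: Dist_le => r; rewrite distrC; [exact: lower_Dist|exact: upper_Dist].
by apply/le_anti; rewrite !H.
Qed.

Lemma Dist_triangle v u w : Dist u w <= Dist u v + Dist v w.
Proof.
apply: Dist_le => r.
  by rewrite (le_trans (ler_distD (lower v r) _ _))// lerD// lower_Dist.
by rewrite (le_trans (ler_distD (upper v r) _ _))// lerD// upper_Dist.
Qed.

Lemma lower_fzero r : lower fzero r = 0.
Proof.
apply/eqP; rewrite -normr_le0; apply: (lower_supported (u := fzero)).
exact: fzero_supported.
Qed.

Lemma upper_fzero r : upper fzero r = 0.
Proof.
apply/eqP; rewrite -normr_le0; apply: (upper_supported (u := fzero)).
exact: fzero_supported.
Qed.

Lemma FnormP u M : Fnorm u <= M <-> supported_in M u.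
Proof.
split=> [uM x ux|uM]; last first.
  apply: Dist_le => r.
    by rewrite lower_fzero subr0; exact: lower_supported.
  by rewrite upper_fzero subr0; exact: upper_supported.
pose z := toI01 (@I01_0 R).
have zx : level u (I01_val z) x by rewrite /level eqxx; exact: subset_closure.
have := le_trans (lower_Dist u fzero z) uM.
have := le_trans (upper_Dist u fzero z) uM.
rewrite lower_fzero upper_fzero !subr0 !ler_norml => /andP[_ h1] /andP[h2 _].
by rewrite (le_trans h2 (lower_le zx)) (le_trans (le_upper zx) h1).
Qed.

End fuzzy_operations.

Record mRF (R : realType) := MkmRF {
  mRF_val :> nat -> fuzzy R ;
  mRF_valP : exists2 M, 0 < M & forall n, Fnorm (mRF_val n) <= M }.

HB.instance Definition _ (R : realType) := gen_eqMixin (mRF R).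
HB.instance Definition _ (R : realType) := gen_choiceMixin (mRF R).

Lemma mRFP (R : realType) (x y : mRF R) : (forall n, x n = y n) -> x = y.
Proof.
case: x y => x xp [y yp] /= /funext xy; rewrite {}xy in xp *.
by rewrite (Prop_irrelevance xp yp).
Qed.

Section mRF_operations.
Context {R : realType}.
Implicit Types (x y z : mRF R).

Lemma madd_proof x y :
  exists2 M, 0 < M & forall n, Fnorm (fadd (x n) (y n)) <= M.
Proof.
have [M M0 xM] := mRF_valP x; have [N N0 yN] := mRF_valP y.
exists (M + N) => [|n]; first exact: addr_gt0.
by apply/FnormP/fadd_supported; exact/FnormP.
Qed.

Definition madd x y : mRF R := MkmRF (madd_proof x y).

Lemma mscale_proof (l : R) x :
  exists2 M, 0 < M & forall n, Fnorm (fscale l (x n)) <= M.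
Proof.
have [M M0 xM] := mRF_valP x.
exists (`|l| * M + 1) => [|n]; first by rewrite ltr_wpDl// mulr_ge0// ltW.
apply: (@le_trans _ _ (`|l| * M)); last by rewrite lerDl.
by apply/FnormP/fscale_supported/FnormP.
Qed.

Definition mscale (l : R) x : mRF R := MkmRF (mscale_proof l x).

Definition mu x y : R := sup (range (fun n => Dist (x n) (y n))).

Lemma mu_le x y M : (forall n, Dist (x n) (y n) <= M) -> mu x y <= M.
Proof. exact: sup_range_le 0%N. Qed.

Lemma le_mu x y n : Dist (x n) (y n) <= mu x y.
Proof.
have [M _ xM] := mRF_valP x; have [N _ yN] := mRF_valP y.
apply: (@le_sup_range R nat (fun n => Dist (x n) (y n)) (M + N)) => {}n.
rewrite (le_trans (Dist_triangle fzero _ _))// lerD ?xM//.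
by rewrite Dist_sym; exact: yN.
Qed.

Lemma muxx x : mu x x = 0.
Proof.
apply/le_anti/andP; split; last exact: le_trans (Dist_ge0 _ _) (le_mu x x 0).
by apply: mu_le => n; rewrite Distxx.
Qed.

Lemma mu_eq0 x y : mu x y = 0 -> x = y.
Proof.
move=> xy; apply: mRFP => n; apply/Dist_eq0/le_anti.
by rewrite Dist_ge0 andbT (le_trans (le_mu x y n))// xy.
Qed.

Lemma mu_sym x y : mu x y = mu y x.
Proof.
have H z z' : mu z z' <= mu z' z.
  by apply: mu_le => n; rewrite Dist_sym le_mu.
by apply/le_anti; rewrite !H.
Qed.

Lemma mu_triangle y x z : mu x z <= mu x y + mu y z.
Proof.
apply: mu_le => n.
by rewrite (le_trans (Dist_triangle (y n) _ _))// lerD// le_mu.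
Qed.

Lemma mlower_proof x : (fun n => lowerC (x n)) \in @MCbar_pred R.
Proof.
have [M M0 xM] := mRF_valP x; apply/asboolP; exists M => n.
by apply: Cnorm_le => r /=; apply/lower_supported/FnormP.
Qed.

Lemma mupper_proof x : (fun n => upperC (x n)) \in @MCbar_pred R.
Proof.
have [M M0 xM] := mRF_valP x; apply/asboolP; exists M => n.
by apply: Cnorm_le => r /=; apply/upper_supported/FnormP.
Qed.

Definition mlower x : MCbar R := MkMCbar (mlower_proof x).

Definition mupper x : MCbar R := MkMCbar (mupper_proof x).

End mRF_operations.

HB.instance Definition _ (R : realType) :=
  @isMetric.Build R (mRF R) (@mu R) (@muxx R) (@mu_eq0 R) (@mu_sym R)
    (@mu_triangle R).

Definition mRF_linear (R : realType) (A : mRF R -> R) : Prop :=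
  (forall x y, A (madd x y) = A x + A y) /\
  (forall (l : R) x, A (mscale l x) = l * A x).

Lemma mRF_continuousP (R : realType) (A : mRF R -> R) :
  continuous A <->
  forall x (e : R), 0 < e ->
    exists2 d, 0 < d & forall y, mu x y < d -> `|A x - A y| < e.
Proof.
split=> [cA x e e0|H x].
  have /cvgrPdist_lt/(_ e e0)/nbhs_ballP[d d0 dP] := cA x.
  by exists d => // y xy; exact: dP.
apply/(@cvgrPdist_lt _ _ _ (nbhs x)) => e /(H x)[d d0 dP].
by apply/nbhs_ballP; exists d.
Qed.

Lemma MIC_continuousP (R : realType) (A : MCbar R -> R) :
  {within MIC (R := R), continuous A} <->
  forall s (e : R), MIC s -> 0 < e ->
    exists2 d, 0 < d & forall t, MIC t -> Phi s t < d -> `|A s - A t| < e.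
Proof.
split=> [/subspace_continuousP cA s e sM e0|H].
  have /cvgrPdist_lt/(_ e e0) := cA s sM.
  rewrite near_withinE => /nbhs_ballP[d d0 dP].
  by exists d => // t tM st; exact: dP.
apply/subspace_continuousP => s sM.
apply/(@cvgrPdist_lt _ _ _ (within (@MIC R) (nbhs s))) => e /(H s e sM)[d d0 dP].
by rewrite near_withinE; apply/nbhs_ballP; exists d => // t st tM; exact: dP.
Qed.

(* Main.v *)
(* An additive and homogeneous functional kills every x with x_- + x_+ = 0,
   because such an x satisfies (-1) . x = x. Hence xstar x depends only on
   x_- + x_+, and the sums x_- + x_+ form a linear subspace on which xstar
   induces a linear functional; L is any algebraic extension of it. This
   subspace contains MIC: an increasing s is the sum of the endpoints
   s - s(1)/2 <= s(1)/2, and this representation depends on s in a Lipschitz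
   way, so continuity of xstar gives that of L on MIC. Conversely x_- and - x_+
   both lie in MIC, and x_- + x_+ is their difference. *)
Require Import Defs.
From HB Require Import structures.
From mathcomp Require Import all_boot all_order all_algebra.
From mathcomp Require Import boolp classical_sets reals topology normedtype.
From mathcomp Require Import ring lra.

Set Implicit Arguments.
Unset Strict Implicit.
Unset Printing Implicit Defensive.

Import Order.TTheory GRing.Theory Num.Theory.
Import numFieldTopology.Exports numFieldNormedType.Exports.

Local Open Scope classical_set_scope.
Local Open Scope ring_scope.

(** * Extension of partial linear functionals *)

(** Here [G] is the graph of a linear functional on a subspace: closure under combinations together
    with the condition at 0 makes it single-valued. By Zorn's lemma it lies in a maximal such graph,
    which must be total. *)
Lemma linear_extension (F : fieldType) (V : lmodType F) (G : set (V * F)) :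
  G !=set0 ->
  (forall a p q, G p -> G q -> G (a *: p.1 + q.1, a * p.2 + q.2)) ->
  (forall r, G (0, r) -> r = 0) ->
  exists L : {scalar V}, forall v r, G (v, r) -> L v = r.
Proof.
move=> G0 Glin Gfun.
pose good (H : set (V * F)) := [/\ G `<=` H,
  forall a p q, H p -> H q -> H (a *: p.1 + q.1, a * p.2 + q.2) &
  forall r, H (0, r) -> r = 0].
have [|H [[HE|[GH Hlin Hfun]] Hmax]] :=
    @Zorn_bigcup _ [set H | H = set0 \/ good H].
- move=> C Cgood Ctot.
  have [[H [CH [p Hp]]]|C0] := pselect (exists H, C H /\ H !=set0); last first.
    left; rewrite -subset0 => p [H CH Hp]; apply: C0.
    by exists H; split => //; exists p.
  have goodC K q : C K -> K q -> good K.
    by move=> /Cgood[->|].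
  right; split.
  + by move=> q Gq; exists H => //; have [GH _ _] := goodC _ _ CH Hp; exact: GH.
  + move=> a q1 q2 [H1 CH1 Hq1] [H2 CH2 Hq2].
    have [H12|H21] := Ctot _ _ CH1 CH2.
      exists H2 => //; have [_ h _] := goodC _ _ CH2 Hq2.
      by apply: h => //; exact: H12.
    exists H1 => //; have [_ h _] := goodC _ _ CH1 Hq1.
    by apply: h => //; exact: H21.
  + by move=> r [K CK Kr]; have [_ _] := goodC _ _ CK Kr; exact.
- exfalso; apply: (Hmax G); last by right; split.
  by rewrite HE; split=> // Gsub; have [p /Gsub] := G0.
have H00 : H (0, 0).
  have [p /GH Hp] := G0.
  by have := Hlin (-1) p p Hp Hp; rewrite scaleN1r mulN1r !addNr.
have HZ a p : H p -> H (a *: p.1, a * p.2).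
  by move=> Hp; have := Hlin a p _ Hp H00; rewrite !addr0.
have Htot v : exists r, H (v, r).
  apply: contrapT => Nv.
  (* If [v] is outside the domain of [H], extend [H] by the value 0 at [v]; this contradicts
     maximality. *)
  pose K := [set q | exists a p, H p /\ q = (p.1 + a *: v, p.2)].
  apply: (Hmax K).
    split; first by move=> [x r] Hp; exists 0, (x, r); rewrite scale0r addr0.
    move=> KH; apply: Nv; exists 0; apply: KH.
    by exists 1, (0, 0); rewrite scale1r add0r.
  right; split.
  - by move=> [x r] /GH Hp; exists 0, (x, r); rewrite scale0r addr0.
  - move=> b _ _ [a1 [p1 [Hp1 ->]]] [a2 [p2 [Hp2 ->]]] /=.
    exists (b * a1 + a2), (b *: p1.1 + p2.1, b * p1.2 + p2.2); split.
      exact: Hlin.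
    by rewrite /= scalerDr scalerDl scalerA addrACA.
  - move=> r [a [[x s] [Hx [/= /esym/eqP xav ->]]]].
    have [a0|a0] := eqVneq a 0.
      by move: xav Hx; rewrite a0 scale0r addr0 => /eqP -> /Hfun.
    (* For [a] nonzero, [x + a *: v = 0] makes [v] a multiple of [x], so [v] would already be in the
       domain of [H]. *)
    exfalso; apply: Nv; exists (- a^-1 * s).
    have := HZ (- a^-1) _ Hx; congr H; congr pair => /=.
    move: xav; rewrite addr_eq0 => /eqP ->.
    by rewrite scalerN scaleNr opprK scalerA mulVf// scale1r.
have [L HL] := choice Htot.
have Huniq v r : H (v, r) -> L v = r.
  move=> Hr; apply/eqP; rewrite eq_sym -subr_eq0; apply/eqP/Hfun.
  have := Hlin (-1) _ _ (HL v) Hr.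
  by rewrite /= scaleN1r addNr mulN1r addrC.
have Llin : linear_for *%R L.
  by move=> a x y; apply: Huniq; exact: Hlin (HL x) (HL y).
pose Lm := GRing.isLinear.Build F V F *%R L Llin.
pose L' : {scalar V} := HB.pack L Lm.
by exists L' => v r /GH; exact: Huniq.
Qed.

(** * One-sided continuity in [Cbar] *)

Section Cbar_limits.
Context {R : realType}.
Implicit Types (f g : Cbar R) (q r : I01 R) (x : R).

Lemma Cbar_left_near f r (e : R) : 0 < I01_val r -> 0 < e ->
  exists q, [/\ 0 < I01_val q, I01_val q < I01_val r & `|f r - f q| < e].
Proof.
move=> r0 e0; have /asboolP[_ lf _ _] := Cbar_valP f.
have /cvgrPdist_lt/(_ e e0) := lf r r0.
rewrite near_withinE => /nbhs_ballP[d /= d0 dP].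
pose m := Num.max (I01_val r / 2) (I01_val r - d / 2).
have mr : m < I01_val r by rewrite gt_max; apply/andP; split; lra.
have m0 : 0 < m by rewrite lt_max; apply/orP; left; lra.
have m01 : 0 <= m <= 1 by rewrite ltW//= (le_trans (ltW mr))// I01_le1.
exists (toI01 m01); split => //; apply: dP => //.
change (`|I01_val r - m| < d); rewrite ger0_norm; last by rewrite subr_ge0 ltW.
have : I01_val r - d / 2 <= m by rewrite le_max lexx orbT.
lra.
Qed.

Lemma Cbar_right_near0 f r (e : R) : I01_val r = 0 -> 0 < e ->
  exists2 d, 0 < d & forall q, 0 < I01_val q -> I01_val q < d -> `|f r - f q| < e.
Proof.
move=> r0 e0; have /asboolP[_ _ _ rf] := Cbar_valP f.
have /cvgrPdist_lt/(_ e e0) := rf r r0.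
rewrite near_withinE => /nbhs_ballP[d /= d0 dP].
exists d => // q q0 qd; apply: dP; last by rewrite /= r0.
by change (`|I01_val r - I01_val q| < d); rewrite r0 sub0r normrN gtr0_norm.
Qed.

(** Left continuity carries bounds from strictly smaller positive levels to [r]. This is how
    conditions known only below a supremum are recovered at the supremum. *)
Lemma Cbar_left_le f r x : 0 < I01_val r ->
  (forall q, 0 < I01_val q -> I01_val q < I01_val r -> f q <= x) -> f r <= x.
Proof.
move=> r0 fx; rewrite leNgt; apply/negP => xr.
have [|q [q0 qr]] := @Cbar_left_near f r (f r - x) r0; first by rewrite subr_gt0.
have := fx q q0 qr; rewrite ltr_norml => ? /andP[_]; lra.
Qed.

Lemma Cbar_eq_pos f g : (forall r, 0 < I01_val r -> f r = g r) ->
  forall r, f r = g r.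
Proof.
move=> fg r; have := I01_ge0 r; rewrite le_eqVlt => /predU1P[/esym r0|/fg//].
apply/eqP; rewrite -subr_eq0 -normr_le0; apply/ler_addgt0Pl => e e0.
have e2 : 0 < e / 2 by lra.
have [d d0 dP] := @Cbar_right_near0 f r (e / 2) r0 e2.
have [d' d'0 d'P] := @Cbar_right_near0 g r (e / 2) r0 e2.
(* A positive level inside both right neighbourhoods of 0, capped at 1 to stay in the unit
   interval. *)
pose m := Num.min 1 (Num.min d d' / 2).
have dd0 : 0 < Num.min d d' by rewrite lt_min d0.
have m0 : 0 < m by rewrite lt_min ltr01 divr_gt0.
have m01 : 0 <= m <= 1 by rewrite ltW//= ge_min lexx.
have mdd : m < Num.min d d' by rewrite gt_min; apply/orP; right; lra.
have md : m < d by rewrite (lt_le_trans mdd)// ge_min lexx.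
have md' : m < d' by rewrite (lt_le_trans mdd)// ge_min lexx orbT.
have := dP (toI01 m01) m0 md; have := d'P (toI01 m01) m0 md'.
rewrite (fg (toI01 m01) m0); set z := g (toI01 m01) => h1 h2.
rewrite -(subrKA z) (le_trans (ler_normD _ _))//.
by move: h1; rewrite distrC; lra.
Qed.

(* Level sets at r = 0 are closures, but right continuity at 0 reduces them to
   the superlevel sets. *)
Lemma level_endpoints (u : fuzzy R) f g : (forall r, f r <= g r) ->
  (forall r x, 0 < I01_val r -> I01_val r <= u x <-> f r <= x <= g r) ->
  (forall r, lower u r = f r) /\ (forall r, upper u r = g r).
Proof.
move=> fg H.
have {}H r x : 0 < I01_val r -> level u (I01_val r) x <-> f r <= x <= g r.
  by move=> r0; rewrite /level gt_eqF//; exact: H.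
split.
  apply: (@Cbar_eq_pos (lowerC u)) => r r0; apply/le_anti/andP; split.
    by apply/lower_le/H => //; rewrite lexx fg.
  by have /(H _ _ r0)/andP[] := lower_level u r.
apply: (@Cbar_eq_pos (upperC u)) => r r0; apply/le_anti/andP; split.
  by have /(H _ _ r0)/andP[] := upper_level u r.
by apply/le_upper/H => //; rewrite lexx fg.
Qed.

(** * Endpoints of sums and scalar multiples *)

Lemma lower_le_upper (u : fuzzy R) r : lower u r <= upper u r.
Proof. exact/lower_le/upper_level. Qed.

Lemma fuzzy_levelP (u : fuzzy R) r x : 0 < I01_val r ->
  I01_val r <= u x <-> lower u r <= x <= upper u r.
Proof. by move=> r0; rewrite -level_itvP /level gt_eqF. Qed.

Lemma fadd_endpoints (u v : fuzzy R) :
  (forall r, lower (fadd u v) r = lower u r + lower v r) /\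
  (forall r, upper (fadd u v) r = upper u r + upper v r).
Proof.
apply: (@level_endpoints (fadd u v) (lowerC u + lowerC v) (upperC u + upperC v)).
  by move=> r; apply: lerD; exact: lower_le_upper.
move=> r x r0; split=> [rx|/andP[]].
  (* The supremum defining the sum yields a splitting of [x] only for levels strictly below [r];
     left continuity then reaches [r]. *)
  have split_lt q : 0 < I01_val q -> I01_val q < I01_val r ->
      lower u q + lower v q <= x <= upper u q + upper v q.
    move=> q0 /lt_le_trans/(_ rx)/fadd_gt[y [z [<- /ltW + /ltW]]].
    move=> /(fuzzy_levelP _ _ q0)/andP[? ?] /(fuzzy_levelP _ _ q0)/andP[? ?].
    by rewrite !lerD.
  apply/andP; split.
    by apply: Cbar_left_le => // q q0 qr; have /andP[] := split_lt q q0 qr.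
  rewrite -lerN2.
  apply: (@Cbar_left_le (- (upperC u + upperC v))) => // q q0 qr.
  by rewrite lerN2; have /andP[] := split_lt q q0 qr.
change (lower u r + lower v r <= x -> x <= upper u r + upper v r ->
  I01_val r <= fadd u v x) => lx xu.
have lu := lower_le_upper u r; have lv := lower_le_upper v r.
(* The least [y] that is at least [lower u r] and keeps [x - y] at most [upper v r]. *)
pose y := Num.max (lower u r) (x - upper v r).
have yE : lower u r <= y <= upper u r.
  by rewrite le_max lexx ge_max lu lerBlDr.
have xyE : lower v r <= x - y <= upper v r.
  by rewrite /y; have [|] := leP (lower u r) (x - upper v r); lra.
rewrite -(subrKC y x); apply: le_trans (le_fadd _ _ _ _).
by rewrite le_min; apply/andP; split; apply/fuzzy_levelP.
Qed.

Lemma fscale_endpoints_gt0 (l : R) (u : fuzzy R) : 0 < l ->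
  (forall r, lower (fscale l u) r = l * lower u r) /\
  (forall r, upper (fscale l u) r = l * upper u r).
Proof.
move=> l0; apply: (@level_endpoints _ (l *: lowerC u) (l *: upperC u)).
  by move=> r; rewrite ler_pM2l// lower_le_upper.
move=> r x r0.
have -> : fscale l u x = u (x / l) by rewrite /= /fscale_fun gt_eqF.
by rewrite fuzzy_levelP// ler_pdivlMr// ler_pdivrMr// !(mulrC _ l).
Qed.

Lemma fscale_endpoints_lt0 (l : R) (u : fuzzy R) : l < 0 ->
  (forall r, lower (fscale l u) r = l * upper u r) /\
  (forall r, upper (fscale l u) r = l * lower u r).
Proof.
move=> l0; apply: (@level_endpoints _ (l *: upperC u) (l *: lowerC u)).
  by move=> r; rewrite ler_nM2l// lower_le_upper.
move=> r x r0.
have -> : fscale l u x = u (x / l) by rewrite /= /fscale_fun lt_eqF.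
by rewrite fuzzy_levelP// ler_ndivlMr// ler_ndivrMr// !(mulrC _ l) andbC.
Qed.

(** A negative factor swaps the two endpoints, which their sum does not see; hence homogeneity for
    every real factor. *)
Lemma fscale_endpoint_sum (l : R) (u : fuzzy R) r :
  lower (fscale l u) r + upper (fscale l u) r = l * (lower u r + upper u r).
Proof.
case: (ltgtP l 0) => [/fscale_endpoints_lt0|/fscale_endpoints_gt0|->].
- by move=> /(_ u)[-> ->]; rewrite -mulrDr addrC.
- by move=> /(_ u)[-> ->]; rewrite mulrDr.
have -> : fscale 0 u = fzero by apply: fuzzyP => x; rewrite /= /fscale_fun eqxx.
by rewrite lower_fzero upper_fzero addr0 mul0r.
Qed.

(** * Fuzzy numbers with prescribed endpoints *)

Lemma is_Cbar_cst (c : R) : (fun=> c) \in @Cbar_pred R.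
Proof.
apply/asboolP; split => [|r _|r _|r _].
- by apply/Defs.bounded_funP; exists `|c|.
- exact: cvg_cst.
- exact: is_cvg_cst.
- exact: cvg_cst.
Qed.

Definition Cbar_cst (c : R) : Cbar R := MkCbar (is_Cbar_cst c).

(** Take [u x] to be the supremum of the levels [r] whose interval [[f r, g r]] contains [x]. These
    intervals are nested, and left continuity makes them exactly the superlevel sets of [u] at
    positive levels. *)
Lemma fuzzy_of_levels (f g : Cbar R) :
  (forall q r, I01_val q <= I01_val r -> f q <= f r) ->
  (forall q r, I01_val q <= I01_val r -> g r <= g q) ->
  (forall r, f r <= g r) ->
  exists u : fuzzy R,
    (forall r, lower u r = f r) /\ (forall r, upper u r = g r).
Proof.
move=> fnd gni fg.
(* Including 0 keeps [A x] nonempty and gives [u x = 0] where no interval of positive level contains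
   [x]. *)
pose A x := [set q : R | q = 0 \/
  exists2 r, I01_val r = q & f r <= x <= g r].
pose u x := sup (A x).
have A0 x : A x !=set0 by exists 0; left.
have A1 x (q : R) : A x q -> q <= 1 by case=> [->//|[r <- _]]; exact: I01_le1.
have Aub x (q : R) : A x q -> q <= u x.
  by move=> Aq; apply: ub_le_sup => //; exists 1 => y; exact: A1.
have u01 x : 0 <= u x <= 1.
  by apply/andP; split; [apply: Aub; left | apply: ge_sup => // y; exact: A1].
have uP r x : 0 < I01_val r -> I01_val r <= u x <-> f r <= x <= g r.
  move=> r0; split=> [rx|fgx]; last by apply: Aub; right; exists r.
  have lt q : I01_val q < I01_val r -> f q <= x <= g q.
    move=> /lt_le_trans/(_ rx)/(sup_gt (A0 x))[s [->|[p <- /andP[fp gp]]]].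
      by rewrite ltNge I01_ge0.
    by move=> /ltW qp; rewrite (le_trans (fnd _ _ qp))//= (le_trans gp)// gni.
  apply/andP; split.
    by apply: Cbar_left_le => // q q0 qr; have /andP[] := lt q qr.
  rewrite -lerN2; apply: (@Cbar_left_le (- g)) => // q q0 qr.
  by rewrite lerN2; have /andP[] := lt q qr.
have toI x : exists r, I01_val r = u x by exists (toI01 (u01 x)).
have [M fM] : exists M, forall r, `|f r| <= M.
  by exists (Cnorm f) => r; exact: le_Cnorm.
have [N gN] : exists N, forall r, `|g r| <= N.
  by exists (Cnorm g) => r; exact: le_Cnorm.
have uf : is_fuzzy u.
  split.
  - exact: u01.
  - have x01 : 0 <= (1 : R) <= 1 by rewrite ler01 lexx.
    exists (f (toI01 x01)); apply/le_anti.
    have /andP[_ ->] /= := u01 (f (toI01 x01)).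
    by apply/(uP (toI01 x01)); rewrite ?lexx ?fg//; exact: ltr01.
  - move=> t x y /andP[t0 t1]; set m := Num.min _ _.
    have mx : m <= u x by rewrite ge_min lexx.
    have my : m <= u y by rewrite ge_min lexx orbT.
    have [m0|m0] := leP m 0.
      by apply: le_trans m0 _; have /andP[] := u01 (t * x + (1 - t) * y).
    have m01 : 0 <= m <= 1.
      by rewrite ltW//= (le_trans mx)//; have /andP[] := u01 x.
    (* Both points lie in the interval of level [m], which is convex. *)
    apply/(uP (toI01 m01)) => //.
    have /(uP (toI01 m01) _ m0)/andP[fx xg] := mx.
    have /(uP (toI01 m01) _ m0)/andP[fy yg] := my.
    by apply/andP; split; nra.
  - move=> x a xa; have [a1|a1] := ltP 1 a.
      by near=> y; apply: le_lt_trans a1; have /andP[] := u01 y.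
    have a0 : 0 < a by apply: le_lt_trans xa; have /andP[] := u01 x.
    have a01 : 0 <= a <= 1 by rewrite ltW.
    (* For [0 < a <= 1] the set where [u < a] is the complement of a closed interval, hence open. *)
    have out y : u y < a <-> y < f (toI01 a01) \/ g (toI01 a01) < y.
      rewrite ltNge; split=> [/negP nay|h].
        have [?|fy] := ltP y (f (toI01 a01)); first by left.
        have [?|gy] := ltP (g (toI01 a01)) y; first by right.
        by exfalso; apply/nay/(uP (toI01 a01)) => //; rewrite fy.
      apply/negP => /(uP (toI01 a01) _ a0)/andP.
      by case: h => h []; rewrite !leNgt h.
    have /out[xf|xg] := xa.
      by have := lt_nbhsl xf; apply: filterS => y ?; apply/out; left.
    by have := lt_nbhsr xg; apply: filterS => y ?; apply/out; right.
  - apply: (@compact_supported _ (Num.max M N)) => x ux.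
    have [r rE] := toI x; rewrite -rE in ux.
    have /(uP _ _ ux)/andP[fx xg] : I01_val r <= u x by rewrite rE.
    rewrite ler_norml; apply/andP; split.
      apply: le_trans fx; rewrite lerNl (le_trans _ (_ : M <= _))//.
        by rewrite (le_trans _ (fM r))// ler_normr lexx orbT.
      by rewrite le_max lexx.
    rewrite (le_trans xg)// (le_trans (ler_norm _))// (le_trans (gN r))//.
    by rewrite le_max lexx orbT.
exists (MkFuzzy uf); apply: level_endpoints => // r x; exact: uP.
Unshelve. all: by end_near. Qed.

End Cbar_limits.

(** * Endpoint sequences *)

Section mRF_endpoints.
Context {R : realType}.
Implicit Types (x y : mRF R) (s t : MCbar R).

Lemma MCbarP s t : (forall n r, s n r = t n r) -> s = t.
Proof.
by move=> st; apply/val_inj/funext => n; apply/val_inj/funext => r; exact: st.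
Qed.

Lemma mlowerD x y : mlower (madd x y) = mlower x + mlower y.
Proof. by apply: MCbarP => n r; exact: (fadd_endpoints (x n) (y n)).1. Qed.

Lemma mupperD x y : mupper (madd x y) = mupper x + mupper y.
Proof. by apply: MCbarP => n r; exact: (fadd_endpoints (x n) (y n)).2. Qed.

Lemma mscale_endpoint_sum (l : R) x :
  mlower (mscale l x) + mupper (mscale l x) = l *: (mlower x + mupper x).
Proof. by apply: MCbarP => n r; exact: fscale_endpoint_sum. Qed.

(** Scaling by -1 turns the endpoints into [- upper] and [- lower], which here are the original
    ones. *)
Lemma mscaleN1_id x : mlower x + mupper x = 0 -> mscale (-1) x = x.
Proof.
move=> x0; have N0 : (-1 : R) < 0 by rewrite oppr_lt0.
have {}x0 n r : lower (x n) r + upper (x n) r = 0.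
  by have := congr1 (fun s : MCbar R => s n r) x0.
apply: mRFP => n; have [lE uE] := fscale_endpoints_lt0 (x n) N0.
apply: fuzzy_ext; apply/funext => r.
  by rewrite lE mulN1r; have /eqP := x0 n r; rewrite addr_eq0 => /eqP ->.
by rewrite uE mulN1r; have /eqP := x0 n r; rewrite addrC addr_eq0 => /eqP ->.
Qed.

Lemma mlower_MIC x : MIC (mlower x).
Proof. by move=> n p q; exact: lower_nd. Qed.

Lemma mupperN_MIC x : MIC (- mupper x).
Proof. by move=> n p q pq; rewrite lerN2; exact: upper_ni. Qed.

Lemma Phi_mlower x y : Phi (mlower x) (mlower y) <= mu x y.
Proof.
apply: Phi_le => n; apply: Cnorm_le => r.
exact: le_trans (lower_Dist _ _ _) (le_mu x y n).
Qed.

Lemma Phi_mupper x y : Phi (mupper x) (mupper y) <= mu x y.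
Proof.
apply: Phi_le => n; apply: Cnorm_le => r.
exact: le_trans (upper_Dist _ _ _) (le_mu x y n).
Qed.

Lemma PhiN s t : Phi (- s) (- t) = Phi s t.
Proof.
suff H (s' t' : MCbar R) : Phi (- s') (- t') <= Phi s' t'.
  by apply/le_anti; rewrite H -{1}(opprK s) -{1}(opprK t) H.
apply: Phi_le => n; rewrite -CnormN.
have -> : - ((- s') n - (- t') n) = s' n - t' n by rewrite -opprD opprK.
exact: le_Phi.
Qed.

Let I1_proof : 0 <= (1 : R) <= 1. Proof. by rewrite ler01 lexx. Qed.
Definition I1 : I01 R := toI01 I1_proof.

(* Subtracting the constant s(1)/2 from an increasing s makes the upper
   endpoint s(1)/2 constant while the endpoints still sum to s. *)
Lemma MIC_endpoint_sum s : MIC s -> exists x : mRF R,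
  (forall n r, lower (x n) r = s n r - s n I1 / 2) /\
  (forall n r, upper (x n) r = s n I1 / 2).
Proof.
move=> sM; have /asboolP[M HM] := MCbar_valP s.
have sB n r : `|s n r| <= M by exact: le_trans (le_Cnorm _ _) (HM n).
have /choice[x xP] n : exists u : fuzzy R,
    (forall r, lower u r = s n r - s n I1 / 2) /\
    (forall r, upper u r = s n I1 / 2).
  apply: (@fuzzy_of_levels _ (s n - Cbar_cst (s n I1 / 2))
                             (Cbar_cst (s n I1 / 2))) => //.
    by move=> q r qr; apply: lerD => //; exact: sM.
  move=> r; rewrite lerBlDr -splitr; apply: sM; exact: I01_le1.
have M0 : 0 <= M by exact: le_trans (sB 0%N I1).
have xM : exists2 N, 0 < N & forall n, Fnorm (x n) <= N.
  (* The endpoints are at most [M + M / 2] in absolute value; adding 1 makes the bound positive even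
     if [M = 0]. *)
  exists (M * 2 + 1) => [|n]; first lra.
  have := sB n I1; rewrite ler_norml => /andP[? ?].
  apply: Dist_le => r; have := sB n r; rewrite ler_norml => /andP[? ?].
    by rewrite lower_fzero (xP n).1 ler_norml; lra.
  by rewrite upper_fzero (xP n).2 ler_norml; lra.
by exists (MkmRF xM); split=> n r /=; have [] := xP n.
Qed.

End mRF_endpoints.

(** * Representation of linear continuous functionals *)

Theorem theorem3p3 (R : realType) (xstar : mRF R -> R) :
  (mRF_linear xstar /\ continuous xstar) <->
  exists L : {scalar MCbar R},
    (forall x : mRF R, xstar x = L (mlower x + mupper x)) /\
    {within MIC (R := R), continuous L}.
Proof.
split=> [[[xD xZ] /mRF_continuousP xcont]|[L [xL /MIC_continuousP Lcont]]].
  (* The graph of the functional induced by [xstar] on the sums of endpoints. *)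
  pose G : set (MCbar R * R) :=
    [set p | exists x, p = (mlower x + mupper x, xstar x)].
  have [|||L LG] := @linear_extension R (MCbar R) G.
  - have zM : MIC (0 : MCbar R) by move=> n p q _; exact: lexx.
    have [x _] := MIC_endpoint_sum zM.
    by exists (mlower x + mupper x, xstar x), x.
  - move=> a _ _ [x ->] [y ->]; exists (madd (mscale a x) y) => /=.
    by rewrite mlowerD mupperD addrACA mscale_endpoint_sum xD xZ.
  (* A zero endpoint sum forces [xstar x = - xstar x]. *)
  - move=> r [x xr]; have -> : r = xstar x := congr1 snd xr.
    have := xZ (-1) x.
    by rewrite (mscaleN1_id (esym (congr1 fst xr : 0 = _))); lra.
  have {}LG x : L (mlower x + mupper x) = xstar x by apply: LG; exists x.
  have LE (s : MCbar R) (x : mRF R) : (forall n r, lower (x n) r = s n r - s n I1 / 2) ->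
      (forall n r, upper (x n) r = s n I1 / 2) -> L s = xstar x.
    move=> lx ux; rewrite -LG; congr (L _); apply: MCbarP => n r.
    by change (s n r = lower (x n) r + upper (x n) r); rewrite lx ux subrK.
  exists L; split => //; apply/MIC_continuousP => s e sM e0.
  have [x [lx ux]] := MIC_endpoint_sum sM.
  have [d d0 dP] := xcont x e e0.
  (* The endpoints built from [s] and [t] differ by at most [3/2] times [Phi s t], so [d / 2] leaves
     room. *)
  exists (d / 2) => [|t tM std]; first by rewrite divr_gt0.
  have [y [ly uy]] := MIC_endpoint_sum tM.
  rewrite (LE s x)// (LE t y)//; apply: dP.
  have stn (n : nat) (r : I01 R) : `|s n r - t n r| <= Phi s t.
    exact: le_trans (le_Cnorm (s n - t n) r) (le_Phi s t n).
  apply: (@le_lt_trans _ _ (Phi s t * 2)); last by rewrite -ltr_pdivlMr.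
  apply: mu_le => n; have := stn n I1; rewrite ler_norml => /andP[? ?].
  apply: Dist_le => r; have := stn n r; rewrite ler_norml => /andP[? ?].
    by rewrite lx ly ler_norml; lra.
  by rewrite ux uy ler_norml; lra.
split; first split.
- by move=> x y; rewrite !xL mlowerD mupperD addrACA linearD.
- by move=> l x; rewrite !xL mscale_endpoint_sum linearZ.
apply/mRF_continuousP => x e e0.
(* Write [L (x_- + x_+)] as [L x_- - L (- x_+)] and allow [e / 2] for each term. *)
have e2 : 0 < e / 2 by rewrite divr_gt0.
have [d d0 dP] := Lcont _ _ (mlower_MIC x) e2.
have [d' d'0 d'P] := Lcont _ _ (mupperN_MIC x) e2.
exists (Num.min d d') => [|y]; first by rewrite lt_min d0.
rewrite lt_min => /andP[xyd xyd'].
have := dP _ (mlower_MIC y) (le_lt_trans (Phi_mlower x y) xyd).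
have := d'P _ (mupperN_MIC y).
rewrite PhiN => /(_ (le_lt_trans (Phi_mupper x y) xyd')).
rewrite !xL !linearD !linearN /= !ltr_norml.
by move=> /andP[? ?] /andP[? ?]; apply/andP; split; lra.
Qed.
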